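(* Let $G=(\mathcal N,\mathcal E)$ be a connected symmetric directed graph on $\mathcal N=\{1,\ldots,n\}$, $n\ge2$, containing all self-arcs $(i,i)$. (i) For every $\eta>0$ there exists a stochastic matrix $A$ (nonnegative entries, row sums equal to $1$) with $a_{ij}=0$ whenever $(i,j)\notin\mathcal E$, having a unique stationary probability vector $\pi$ ($\pi^TA=\pi^T$), all of whose entries are positive, and such that the convergence rate of $x(t+1)=Ax(t)$ satisfies $\rho\le\eta$. (ii) For every $\epsilon>0$ there exists a stochastic matrix $A$ with $a_{ij}=0$ whenever $(i,j)\notin\mathcal E$, having a unique stationary probability vector, all of whose entries are positive, and such that the convergence time of $x(t+1)=Ax(t)$ satisfies $T_n(\epsilon)\le n$.
   Context: A directed graph is symmetric if $(i,j)\in\mathcal E$ iff $(j,i)\in\mathcal E$. Let $X=\{c\mathbf 1:c\in\mathbb R\}$, with $\mathbf 1$ the all-ones vector. For a matrix $A$ such that $x(t+1)=Ax(t)$ converges to an element $x^*$ of $X$ for every $x(0)$ (this is part of what is required of the matrices in the claim), the convergence rate and convergence time are $$\rho=\sup_{x(0)\notin X}\lim_{t\to\infty}\Big(\frac{\|x(t)-x^*\|_2}{\|x(0)-x^*\|_2}\Big)^{1/t},$$ $$T_n(\epsilon)=\min\Big\{\tau:\ \frac{\|x(t)-x^*\|_\infty}{\|x(0)-x^*\|_\infty}\le\epsilon\ \ \forall\,t\ge\tau,\ \forall\,x(0)\notin X\Big\}.$$ *)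

(* Defs.v *)
From mathcomp Require Import all_boot all_order all_algebra.
From mathcomp Require Import all_classical all_reals all_analysis.
Set Implicit Arguments.
Unset Strict Implicit.
Unset Printing Implicit Defensive.
Import Order.TTheory GRing.Theory Num.Theory.
Import numFieldNormedType.Exports.
Local Open Scope classical_set_scope.
Local Open Scope ring_scope.

Definition stochastic (R : realType) (n : nat) (A : 'M[R]_n) : Prop :=
  (forall i j, 0 <= A i j) /\ (forall i, \sum_j A i j = 1).

Definition supported (R : realType) (n : nat) (e : rel 'I_n) (A : 'M[R]_n) :
  Prop := forall i j, ~~ e i j -> A i j = 0.

Definition prob_vector (R : realType) (n : nat) (p : 'cV[R]_n) : Prop :=
  (forall i, 0 <= p i 0) /\ \sum_i p i 0 = 1.

Definition stationary (R : realType) (n : nat) (A : 'M[R]_n) (p : 'cV[R]_n) :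
  Prop := prob_vector p /\ p^T *m A = p^T.

Definition unique_positive_stationary (R : realType) (n : nat) (A : 'M[R]_n) :
  Prop :=
  exists p : 'cV[R]_n,
    [/\ stationary A p,
        forall q : 'cV[R]_n, stationary A q -> q = p
      & forall i, 0 < p i 0].

Definition consensus_set (R : realType) (n : nat) : set 'cV[R]_n :=
  [set x | exists c : R, x = const_mx c].
Arguments consensus_set : clear implicits.

Definition traj (R : realType) (n : nat) (A : 'M[R]_n) (x0 : 'cV[R]_n) :
  nat -> 'cV[R]_n := fun t => iter t (mulmx A) x0.

Definition reaches_consensus (R : realType) (n : nat) (A : 'M[R]_n) : Prop :=
  forall x0 : 'cV[R]_n,
    exists2 y, consensus_set R n y & traj A x0 @ \oo --> y.

(* Junk unless the trajectory converges, as [reaches_consensus A] ensures. *)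
Definition traj_limit (R : realType) (n : nat) (A : 'M[R]_n)
  (x0 : 'cV[R]_n) : 'cV[R]_n := lim (traj A x0 @ \oo).

Definition norm2 (R : realType) (n : nat) (x : 'cV[R]_n) : R :=
  Num.sqrt (\sum_i x i 0 ^+ 2).

(* The value at t = 0 is irrelevant to the limit. For t > 0, [powR] sends the
   base 0 to 0, so a trajectory that reaches its limit in finite time has
   rate 0. *)
Definition rate_seq (R : realType) (n : nat) (A : 'M[R]_n) (x0 : 'cV[R]_n) :
  nat -> R := fun t =>
  (norm2 (traj A x0 t - traj_limit A x0) / norm2 (x0 - traj_limit A x0))
    `^ (t%:R^-1).

(* Besides the value of the supremum, this asserts that all the limits exist
   and that the supremum is finite, so no default value is involved. *)
Definition is_convergence_rate (R : realType) (n : nat) (A : 'M[R]_n)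
  (rho : R) : Prop :=
  (forall x0, ~ consensus_set R n x0 -> cvg (rate_seq A x0 @ \oo)) /\
  ereal_sup [set (lim (rate_seq A x0 @ \oo))%:E
            | x0 in ~` consensus_set R n] = rho%:E.

(* The norm `| _ | that MathComp-Analysis puts on matrices is the sup norm. *)
Definition eps_settled (R : realType) (n : nat) (A : 'M[R]_n) (eps : R)
  (tau : nat) : Prop :=
  forall t, (tau <= t)%N -> forall x0, ~ consensus_set R n x0 ->
    `|traj A x0 t - traj_limit A x0| / `|x0 - traj_limit A x0| <= eps.

Definition is_convergence_time (R : realType) (n : nat) (A : 'M[R]_n)
  (eps : R) (T : nat) : Prop :=
  eps_settled A eps T /\
  (forall tau, eps_settled A eps tau -> (T <= tau)%N).

(* Main.v *)
Require Import Defs.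
From mathcomp Require Import all_boot all_order all_algebra.
From mathcomp Require Import all_classical all_reals all_analysis.
From mathcomp Require Import ring lra.
Import Order.TTheory GRing.Theory Num.Theory.
Import numFieldNormedType.Exports.
Local Open Scope ring_scope.

Set Implicit Arguments.
Unset Strict Implicit.
Unset Printing Implicit Defensive.

(** Fix a root r, let d(i) be the graph distance from i to r, and take the
chain that moves from i to a neighbour k (possibly i itself) with probability
proportional to delta ^ d(k).  Two features of this chain give the theorem.

It is reversible, with stationary vector proportional to
delta ^ d(i) * sum_k e(i,k) delta ^ d(k); every entry is positive.

For small delta it is almost deterministic: from each node it moves closer to
the root, or stays at the root, except with probability at most n * delta.
After n > max d steps every row of A ^ n is therefore nearly concentrated at
r, so that on the invariant hyperplane of vectors of stationary mean 0 the map
A ^ n contracts the sup norm by a factor q = 4 n^2 delta, as small as desired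
([approach_root_contracts], [contracting_chain_exists]).

The contraction yields convergence to the stationary mean ([traj_cvg_mean])
and uniqueness of the stationary vector.  Since A does not increase the sup
norm, being within q at time n is being within q at all later times: this is
the bound on the convergence time ([contracts_settled]).

For the rate, the limits that define it have to exist.  Reversibility makes A
self-adjoint for the scalar product weighted by the stationary vector, so
Cauchy-Schwarz makes the weighted energy E(t) of a trajectory log-convex in t
([energy_log_convex]).  Hence the increments of ln E are monotone, ln E(t) / t
converges by Cesaro, and comparing norms transfers this to the Euclidean norm
([log_energy_slope_cvg]).  Along multiples of n the contraction bounds the
limit by q ^ (1/n), which is at most eta once q <= eta ^ n
([centered_rate_cvg]). *)

(** * Exponential growth rates of real sequences *)

(** Convexity makes the increments of b nondecreasing; being bounded, they
converge, and b t / t is their Cesaro mean up to b 0 / t. *)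
Lemma convex_slope_cvg (R : realType) (b : nat -> R) (M : R) :
  (forall t, b t.+1 - b t <= b t.+2 - b t.+1) ->
  (forall t, b t.+1 - b t <= M) ->
  cvgn (fun t => b t / t%:R).
Proof.
move=> b_convex b_slope.
pose D t := b t.+1 - b t.
have /cvg_ex[/= l D_cvg] : cvgn D.
  apply: nondecreasing_is_cvgn; last by exists M => _ [t _ <-]; exact: b_slope.
  by apply/nondecreasing_seqP.
have b0_cvg : ((fun t : nat => b 0%N * harmonic t) @ \oo --> b 0%N * 0)%classic.
  by apply: cvgM; [exact: cvg_cst|exact: cvg_harmonic].
apply/cvg_ex; exists (l + b 0%N * 0); rewrite -cvg_shiftS.
refine (cvg_trans _ (cvgD (cesaro D_cvg) b0_cvg)).
apply: near_eq_cvg; apply: nearW => t /=.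
rewrite fctE /arithmetic_mean /harmonic /series /= telescope_sumr// mulrBr.
by rewrite [_ * b 0%N]mulrC subrK mulrC.
Qed.

Lemma slope_cvg_close (R : realType) (b l : nat -> R) (K : R) :
  (forall t, `|l t - b t| <= K) ->
  cvgn (fun t => b t / t%:R) -> cvgn (fun t => l t / t%:R).
Proof.
move=> lb b_cvg.
have K_cvg : ((fun t : nat => K * harmonic t) @ \oo --> (0 : R))%classic.
  by rewrite -(mulr0 K); apply: cvgM; [exact: cvg_cst|exact: cvg_harmonic].
have d_cvg : ((fun t => (l t - b t) / t%:R) @ \oo --> (0 : R))%classic.
  rewrite -cvg_shiftS; apply/norm_cvg0P.
  apply: squeeze_cvgr (@cvg_cst _ (0 : R) _ _ _) K_cvg.
  apply: nearW => t /=; rewrite normr_ge0 normrM /harmonic/=.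
  by rewrite [X in _ * X]ger0_norm ?invr_ge0// ler_wpM2r ?invr_ge0.
case/cvg_ex: b_cvg => /= c b_cvg; apply/cvg_ex; exists (0 + c).
refine (cvg_trans _ (cvgD d_cvg b_cvg)).
apply: near_eq_cvg; apply: nearW => t /=.
by rewrite fctE mulrBl subrK.
Qed.

(** A limit that is known to exist can be bounded along the multiples of m,
where the additive constant C is washed out by the division. *)
Lemma slope_lim_le (R : realType) (l : nat -> R) (m : nat) (C h : R) :
  (0 < m)%N -> cvgn (fun t => l t / t%:R) ->
  (forall k, l (k * m)%N <= C + h *+ (k * m)) ->
  limn (fun t => l t / t%:R) <= h.
Proof.
move=> m_gt0 /cvg_ex[/= L l_cvg] l_le.
rewrite (cvg_lim (@norm_hausdorff _ _) l_cvg).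
have sub_cvg : ((fun k => (k.+1 * m)%N) @ \oo --> \oo)%classic.
  apply/cvgnyPge => N; near=> k.
  apply: (@leq_trans k); first by near: k; exact: nbhs_infty_ge.
  by rewrite (leq_trans (leqnSn k))// leq_pmulr.
have lk_cvg := cvg_comp _ _ sub_cvg l_cvg.
have C_cvg : ((fun t : nat => `|C| * harmonic t + h) @ \oo --> 0 + h)%classic.
  apply: cvgD; last exact: cvg_cst.
  by rewrite -(mulr0 `|C|); apply: cvgM; [exact: cvg_cst|exact: cvg_harmonic].
rewrite -[h]add0r -(cvg_lim (@norm_hausdorff _ _) lk_cvg).
rewrite -(cvg_lim (@norm_hausdorff _ _) C_cvg).
apply: ler_lim; [exact: cvgP lk_cvg|exact: cvgP C_cvg|apply: nearW => k /=].
have km_gt0 : 0 < (k.+1 * m)%:R :> R by rewrite ltr0n muln_gt0.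
rewrite ler_pdivrMr// (le_trans (l_le _))// mulrDl -[h *+ _]mulr_natr lerD2r.
rewrite /harmonic/= natrM mulrA mulfVK ?pnatr_eq0//.
by rewrite (le_trans (ler_norm _))// ler_peMr// ler1n.
Unshelve. all: by end_near.
Qed.

Lemma powR_slope_cvg (R : realType) (f : nat -> R) (L : R) :
  (forall t, 0 < f t) -> ((fun t => ln (f t) / t%:R) @ \oo --> L)%classic ->
  ((fun t => f t `^ (t%:R^-1)) @ \oo --> expR L)%classic.
Proof.
move=> f_gt0 l_cvg.
rewrite (_ : (fun t => _) = expR \o (fun t => ln (f t) / t%:R)).
  by apply: continuous_cvg => //; exact: continuous_expR.
by apply/funext => t /=; rewrite /powR gt_eqF// mulrC.
Qed.

(** * Stochastic matrices contracting the centered vectors *)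

Lemma entry_le_norm (R : realType) (n : nat) (x : 'cV[R]_n) i :
  `|x i 0| <= `|x|.
Proof.
by rewrite /Num.norm/= mx_normrE; apply/bigmax_geP; right; exists (i, 0).
Qed.

Lemma norm_le_entry (R : realType) (n : nat) (x : 'cV[R]_n) (c : R) :
  0 <= c -> (forall i, `|x i 0| <= c) -> `|x| <= c.
Proof.
move=> c_ge0 xc; rewrite /Num.norm/= mx_normrE.
by apply/bigmax_leP; split=> // -[i j] _ /=; rewrite ord1.
Qed.

Lemma norm_attained (R : realType) (n : nat) (x : 'cV[R]_n) :
  x != 0 -> exists i, `|x| = `|x i 0|.
Proof.
rewrite -normr_eq0 => /mx_norm_neq0 [[i j]] /= xij.
by exists i; rewrite -(ord1 j).
Qed.

Lemma stochastic_norm_le (R : realType) (n : nat) (A : 'M[R]_n)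
  (x : 'cV[R]_n) : stochastic A -> `|A *m x| <= `|x|.
Proof.
move=> [A_ge0 A_sum]; apply: norm_le_entry => // i; rewrite mxE.
rewrite (le_trans (ler_norm_sum _ _ _))//.
rewrite -[leRHS]mul1r -(A_sum i) mulr_suml; apply: ler_sum => j _.
by rewrite normrM ger0_norm// ler_wpM2l// entry_le_norm.
Qed.

Lemma prob_mean_norm_le (R : realType) (n : nat) (p x : 'cV[R]_n) :
  prob_vector p -> `|(p^T *m x) 0 0| <= `|x|.
Proof.
move=> [p_ge0 p_sum]; rewrite mxE (le_trans (ler_norm_sum _ _ _))//.
rewrite -[leRHS]mul1r -p_sum mulr_suml; apply: ler_sum => j _.
by rewrite normrM mxE ger0_norm// ler_wpM2l// entry_le_norm.
Qed.

Lemma stochastic_const (R : realType) (n : nat) (A : 'M[R]_n) (c : R) :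
  stochastic A -> A *m (const_mx c : 'cV_n) = const_mx c.
Proof.
move=> [_ A_sum]; apply/matrixP => i j; rewrite !mxE.
by under eq_bigr do rewrite mxE; rewrite -mulr_suml A_sum mul1r.
Qed.

Lemma prob_mean_const (R : realType) (n : nat) (p : 'cV[R]_n) (c : R) :
  prob_vector p -> (p^T *m (const_mx c : 'cV_n)) 0 0 = c.
Proof.
move=> [_ p_sum]; rewrite mxE; under eq_bigr do rewrite !mxE.
by rewrite -mulr_suml p_sum mul1r.
Qed.

Lemma trajD (R : realType) (n : nat) (A : 'M[R]_n) (x : 'cV[R]_n) s t :
  traj A x (s + t) = traj A (traj A x t) s.
Proof. exact: iterD. Qed.

Lemma traj_norm_le (R : realType) (n : nat) (A : 'M[R]_n) (x : 'cV[R]_n) s t :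
  stochastic A -> (s <= t)%N -> `|traj A x t| <= `|traj A x s|.
Proof.
move=> A_st /subnK <-; elim: (t - s)%N => // k IHk.
by rewrite addSn; apply: le_trans IHk; exact: stochastic_norm_le.
Qed.

Lemma traj_mean (R : realType) (n : nat) (A : 'M[R]_n) (p x : 'cV[R]_n) t :
  p^T *m A = p^T -> p^T *m traj A x t = p^T *m x.
Proof. by move=> pA; elim: t => //= t <-; rewrite mulmxA pA. Qed.

Lemma traj_sub_const (R : realType) (n : nat) (A : 'M[R]_n) (x : 'cV[R]_n)
  (c : R) t : stochastic A ->
  traj A (x - const_mx c) t = traj A x t - const_mx c.
Proof.
by move=> A_st; elim: t => //= t ->; rewrite mulmxBr stochastic_const.
Qed.

(** The number of steps is the dimension n because the distance to the root in
a connected graph on n nodes is less than n. Vectors killed by p^T form an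
invariant complement of the consensus set when p is stationary. *)
Definition contracts (R : realType) (n : nat) (A : 'M[R]_n) (p : 'cV[R]_n)
  (q : R) : Prop :=
  forall y : 'cV[R]_n, p^T *m y = 0 -> `|traj A y n| <= q * `|y|.

Lemma contracts_iter (R : realType) (n : nat) (A : 'M[R]_n) (p y : 'cV[R]_n)
  (q : R) k : 0 <= q -> p^T *m A = p^T -> contracts A p q ->
  p^T *m y = 0 -> `|traj A y (k * n)| <= q ^+ k * `|y|.
Proof.
move=> q_ge0 pA A_con py; elim: k => [|k IHk]; first by rewrite expr0 mul1r.
rewrite mulSn trajD (le_trans (A_con _ _))//; first by rewrite traj_mean.
by rewrite exprS -mulrA ler_wpM2l.
Qed.

(** The sup norms along the trajectory decrease to a limit L, and shifting time
by n gives L <= q * L. *)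
Lemma centered_traj_cvg0 (R : realType) (n : nat) (A : 'M[R]_n)
  (p y : 'cV[R]_n) (q : R) : stochastic A -> p^T *m A = p^T ->
  0 <= q < 1 -> contracts A p q -> p^T *m y = 0 ->
  (traj A y @ \oo --> (0 : 'cV[R]_n))%classic.
Proof.
move=> A_st pA /andP[q_ge0 q_lt1] A_con py; apply/norm_cvg0P.
pose u t := `|traj A y t|.
have u_cvg : cvgn u.
  apply: nonincreasing_is_cvgn; last first.
    by exists 0 => _ [t _ <-]; exact: normr_ge0.
  by move=> s t st; exact: traj_norm_le.
have shift_cvg : ((fun t => u (t + n)%N) @ \oo --> limn u)%classic.
  by rewrite cvg_shiftn.
have q_cvg : ((fun t => q * u t) @ \oo --> q * limn u)%classic.
  by apply: cvgM; [exact: cvg_cst|exact: u_cvg].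
have lim_ge0 : 0 <= limn u.
  by apply: limr_ge => //; apply: nearW => t; exact: normr_ge0.
have lim_le : limn u <= q * limn u.
  rewrite -[leLHS](cvg_lim (@norm_hausdorff _ _) shift_cvg).
  rewrite -[leRHS](cvg_lim (@norm_hausdorff _ _) q_cvg).
  apply: ler_lim; [exact: cvgP shift_cvg|exact: cvgP q_cvg|].
  by apply: nearW => t /=; rewrite /u addnC trajD A_con// traj_mean.
have lim0 : limn u = 0 by nra.
by rewrite -lim0.
Qed.

Lemma mean_centered (R : realType) (n : nat) (p x : 'cV[R]_n) :
  prob_vector p -> p^T *m (x - const_mx ((p^T *m x) 0 0)) = 0.
Proof.
move=> p_prob; apply/matrixP => i j; rewrite !ord1 mulmxBr.
by rewrite [LHS]mxE [X in _ + X]mxE prob_mean_const// subrr mxE.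
Qed.

Lemma traj_cvg_mean (R : realType) (n : nat) (A : 'M[R]_n)
  (p x : 'cV[R]_n) (q : R) : stochastic A -> stationary A p ->
  0 <= q < 1 -> contracts A p q ->
  (traj A x @ \oo --> (const_mx ((p^T *m x) 0 0) : 'cV[R]_n))%classic.
Proof.
move=> A_st [p_prob pA] q01 A_con; apply/subr_cvg0.
set c := (p^T *m x) 0 0.
have := centered_traj_cvg0 A_st pA q01 A_con (mean_centered x p_prob).
by apply: cvg_trans; apply: near_eq_cvg; apply: nearW => t;
  rewrite traj_sub_const.
Qed.

Lemma traj_limitE (R : realType) (n : nat) (A : 'M[R]_n)
  (p x : 'cV[R]_n) (q : R) : stochastic A -> stationary A p ->
  0 <= q < 1 -> contracts A p q ->
  traj_limit A x = const_mx ((p^T *m x) 0 0).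
Proof.
move=> A_st p_st q01 A_con; apply: cvg_lim; first exact: norm_hausdorff.
exact: traj_cvg_mean p_st q01 A_con.
Qed.

Lemma contracts_reaches_consensus (R : realType) (n : nat) (A : 'M[R]_n)
  (p : 'cV[R]_n) (q : R) : stochastic A -> stationary A p ->
  0 <= q < 1 -> contracts A p q -> reaches_consensus A.
Proof.
move=> A_st p_st q01 A_con x; exists (const_mx ((p^T *m x) 0 0)).
  by exists ((p^T *m x) 0 0).
exact: traj_cvg_mean p_st q01 A_con.
Qed.

(** Pairing a stationary r with a vector y of p-mean 0 gives the same value at
all times, while the trajectory of y tends to 0; so r and p induce the same
mean. *)
Lemma contracts_stationary_unique (R : realType) (n : nat) (A : 'M[R]_n)
  (p r : 'cV[R]_n) (q : R) : stochastic A -> stationary A p ->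
  0 <= q < 1 -> contracts A p q -> stationary A r -> r = p.
Proof.
move=> A_st [p_prob pA] q01 A_con [r_prob rA].
suff mean_eq (x : 'cV[R]_n) : (r^T *m x) 0 0 = (p^T *m x) 0 0.
  by apply/matrixP => i j; rewrite ord1; have := mean_eq (delta_mx i 0);
    rewrite -!colE !mxE.
set c := (p^T *m x) 0 0; set y := x - const_mx c.
have py : p^T *m y = 0 by exact: mean_centered.
have -> : (r^T *m x) 0 0 = (r^T *m y) 0 0 + c.
  by rewrite mulmxBr [in RHS]mxE [X in _ + X + _]mxE prob_mean_const// subrK.
suff : `|(r^T *m y) 0 0| <= 0 by rewrite normr_le0 => /eqP ->; rewrite add0r.
have /norm_cvg0P y_cvg := centered_traj_cvg0 A_st pA q01 A_con py.
rewrite -(cvg_lim (@norm_hausdorff _ _) y_cvg).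
apply: limr_ge; first exact: cvgP y_cvg.
by apply: nearW => t; rewrite -(traj_mean y t rA) prob_mean_norm_le.
Qed.

Lemma centered_neq0 (R : realType) (n : nat) (x : 'cV[R]_n) (c : R) :
  ~ consensus_set R n x -> x - const_mx c != 0.
Proof.
by move=> x_ncons; apply/eqP => /subr0_eq xc; apply: x_ncons; exists c.
Qed.

Lemma contracts_settled (R : realType) (n : nat) (A : 'M[R]_n)
  (p : 'cV[R]_n) (q : R) : stochastic A -> stationary A p ->
  0 <= q < 1 -> contracts A p q -> eps_settled A q n.
Proof.
move=> A_st p_st q01 A_con t nt x x_ncons.
rewrite (traj_limitE x A_st p_st q01 A_con) -traj_sub_const//.
rewrite ler_pdivrMr ?normr_gt0 ?centered_neq0//.
apply: le_trans (traj_norm_le _ A_st nt) (A_con _ _).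
by apply: mean_centered; case: p_st.
Qed.

(** * Reversibility and the energy *)

Definition reversible (R : realType) (n : nat) (A : 'M[R]_n) (p : 'cV[R]_n) :
  Prop := forall i j, p i 0 * A i j = p j 0 * A j i.

Lemma reversible_invariant (R : realType) (n : nat) (A : 'M[R]_n)
  (p : 'cV[R]_n) : stochastic A -> reversible A p -> p^T *m A = p^T.
Proof.
move=> [_ A_sum] A_rev; apply/matrixP => i j; rewrite ord1 !mxE.
under eq_bigr do rewrite mxE A_rev.
by rewrite -mulr_sumr A_sum mulr1.
Qed.

Definition wdot (R : realType) (n : nat) (p x y : 'cV[R]_n) : R :=
  \sum_i p i 0 * x i 0 * y i 0.

Lemma wdot_adjoint (R : realType) (n : nat) (A : 'M[R]_n) (p x y : 'cV[R]_n) :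
  reversible A p -> wdot p (A *m x) y = wdot p x (A *m y).
Proof.
move=> A_rev; rewrite /wdot.
under eq_bigr do rewrite mxE mulr_sumr mulr_suml.
under [in RHS]eq_bigr do rewrite mxE mulr_sumr.
rewrite exchange_big; apply: eq_bigr => i _; apply: eq_bigr => j _ /=.
by rewrite mulrA A_rev; ring.
Qed.

(** The weights may vanish, so the form is only semidefinite; the case where
both x and y have zero energy has to be treated apart. *)
Lemma wdot_cauchy_schwarz (R : realType) (n : nat) (p x y : 'cV[R]_n) :
  (forall i, 0 <= p i 0) -> wdot p x y ^+ 2 <= wdot p x x * wdot p y y.
Proof.
move=> p_ge0; set a := wdot p x x; set b := wdot p x y; set c := wdot p y y.
have quad s t : 0 <= s ^+ 2 * a - 2 * s * t * b + t ^+ 2 * c.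
  have -> : s ^+ 2 * a - 2 * s * t * b + t ^+ 2 * c =
            \sum_i p i 0 * (s * x i 0 - t * y i 0) ^+ 2.
    rewrite /a /b /c /wdot !mulr_sumr -sumrB -big_split /=.
    by apply: eq_bigr => i _; ring.
  by apply: sumr_ge0 => i _; rewrite mulr_ge0// sqr_ge0.
have a_ge0 : 0 <= a by have := quad 1 0; lra.
have c_ge0 : 0 <= c by have := quad 0 1; lra.
have [c0|c_neq0] := eqVneq c 0; last first.
  have c_gt0 : 0 < c by rewrite lt_def c_neq0.
  by rewrite -subr_ge0 -(pmulr_rge0 _ c_gt0); have := quad c b; lra.
have [a0|a_neq0] := eqVneq a 0; last first.
  have a_gt0 : 0 < a by rewrite lt_def a_neq0.
  by rewrite -subr_ge0 -(pmulr_rge0 _ a_gt0); have := quad b a; lra.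
by have := quad 1 b; rewrite a0 c0; lra.
Qed.

(** Self-adjointness gives E(t+1) = <A^t y, A^(t+2) y>. *)
Lemma energy_log_convex (R : realType) (n : nat) (A : 'M[R]_n)
  (p y : 'cV[R]_n) t : (forall i, 0 <= p i 0) -> reversible A p ->
  wdot p (traj A y t.+1) (traj A y t.+1) ^+ 2 <=
  wdot p (traj A y t) (traj A y t) * wdot p (traj A y t.+2) (traj A y t.+2).
Proof.
move=> p_ge0 A_rev.
have -> : wdot p (traj A y t.+1) (traj A y t.+1) =
          wdot p (traj A y t) (traj A y t.+2) by exact: wdot_adjoint.
exact: wdot_cauchy_schwarz.
Qed.

Lemma norm2_sq (R : realType) (n : nat) (x : 'cV[R]_n) :
  norm2 x ^+ 2 = \sum_i x i 0 ^+ 2.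
Proof. by rewrite sqr_sqrtr//; apply: sumr_ge0 => i _; exact: sqr_ge0. Qed.

Lemma norm_le_norm2 (R : realType) (n : nat) (x : 'cV[R]_n) :
  `|x| ^+ 2 <= norm2 x ^+ 2.
Proof.
have [->|/norm_attained[i ->]] := eqVneq x 0.
  by rewrite normr0 expr0n sqr_ge0.
rewrite norm2_sq real_normK ?num_real// (bigD1 i)//= lerDl.
by apply: sumr_ge0 => j _; exact: sqr_ge0.
Qed.

Lemma norm2_le_norm (R : realType) (n : nat) (x : 'cV[R]_n) :
  norm2 x ^+ 2 <= n%:R * `|x| ^+ 2.
Proof.
rewrite norm2_sq mulr_natl -[X in _ *+ X]card_ord -sumr_const.
apply: ler_sum => i _.
by rewrite -[leLHS]real_normK ?num_real// lerXn2r ?nnegrE// entry_le_norm.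
Qed.

Lemma norm2_gt0 (R : realType) (n : nat) (x : 'cV[R]_n) :
  x != 0 -> 0 < norm2 x.
Proof.
move=> x_neq0; have x_gt0 : 0 < `|x| by rewrite normr_gt0.
rewrite lt_def sqrtr_ge0 andbT; apply/eqP => x0.
by have := norm_le_norm2 x; rewrite x0; nra.
Qed.

Lemma energy_le_norm2 (R : realType) (n : nat) (p x : 'cV[R]_n) :
  prob_vector p -> wdot p x x <= norm2 x ^+ 2.
Proof.
move=> [p_ge0 p_sum]; rewrite norm2_sq; apply: ler_sum => i _.
rewrite -mulrA -expr2 ler_piMl ?sqr_ge0//.
by rewrite -p_sum (bigD1 i)//= lerDl sumr_ge0.
Qed.

Lemma norm2_le_energy (R : realType) (n : nat) (p x : 'cV[R]_n) (m : R) :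
  (forall i, m <= p i 0) -> m * norm2 x ^+ 2 <= wdot p x x.
Proof.
move=> mp; rewrite norm2_sq mulr_sumr; apply: ler_sum => i _.
by rewrite -mulrA -expr2 ler_wpM2r ?sqr_ge0.
Qed.

Lemma positive_lower_bound (R : realType) (n : nat) (p : 'cV[R]_n) :
  (forall i, 0 < p i 0) -> exists2 m : R, 0 < m & forall i, m <= p i 0.
Proof.
move=> p_gt0; exists (\big[Num.min/1]_i p i 0); last first.
  by move=> i; exact: bigmin_le_cond.
by apply/bigmin_gtP; split=> // i _.
Qed.

(** * Existence and size of the exponential rate of a trajectory *)

(** For positive t the base 0 has power 0, so the sequence is eventually
constant. *)
Lemma rate_cvg_of_vanishing (R : realType) (n : nat) (A : 'M[R]_n)
  (y : 'cV[R]_n) s : traj A y s = 0 ->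
  ((fun t => (norm2 (traj A y t) / norm2 y) `^ (t%:R^-1)) @ \oo -->
    (0 : R))%classic.
Proof.
move=> ys; apply: cvg_near_cst; near=> t.
have st : (s < t)%N by near: t; exact: nbhs_infty_gt.
have -> : traj A y t = 0.
  rewrite -(subnK (ltnW st)) trajD ys; elim: (t - s)%N => //= k ->.
  exact: mulmx0.
have -> : norm2 (0 : 'cV[R]_n) = 0.
  by rewrite /norm2 big1 ?sqrtr0// => i _; rewrite mxE expr0n.
by rewrite mul0r powR0// invr_eq0 pnatr_eq0 -lt0n (leq_ltn_trans _ st).
Unshelve. all: by end_near.
Qed.

(** The logarithm of the energy is convex in time, and its increments are
bounded above since A is nonexpansive for the sup norm, which is equivalent to
the energy norm. The Euclidean and energy norms have bounded ratio, which does
not affect the slope. *)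
Lemma log_energy_slope_cvg (R : realType) (n : nat) (A : 'M[R]_n)
  (p y : 'cV[R]_n) : stochastic A -> prob_vector p -> reversible A p ->
  (forall i, 0 < p i 0) -> (forall t, traj A y t != 0) ->
  cvgn (fun t => ln (norm2 (traj A y t) / norm2 y) / t%:R).
Proof.
move=> A_st p_prob A_rev p_gt0 y_neq0.
have [m m_gt0 mp] := positive_lower_bound p_gt0.
pose z t := traj A y t.
pose N t := norm2 (z t) ^+ 2; pose E t := wdot p (z t) (z t).
have norm_gt0 t : 0 < norm2 (z t) by exact: norm2_gt0.
have N_gt0 t : 0 < N t by rewrite exprn_gt0.
have mN_le t : m * N t <= E t by exact: norm2_le_energy.
have E_le t : E t <= N t by exact: energy_le_norm2.
have E_gt0 t : 0 < E t by apply: lt_le_trans (mN_le t); rewrite mulr_gt0.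
have n_gt0 : (0 < n)%N.
  rewrite lt0n; apply: contraNneq (y_neq0 0%N) => n0; subst n.
  by apply/eqP/matrixP => -[].
have lnN t : ln (N t) = 2 * ln (norm2 (z t)).
  by rewrite lnXn// mulr_natl.
apply: (@slope_cvg_close _ (fun t => ln (E t) / 2) _
  (`|ln m| + `|ln (norm2 y)|)).
  move=> t; rewrite ln_div ?posrE//; last exact: (norm_gt0 0%N).
  have h1 : ln (E t) <= 2 * ln (norm2 (z t)).
    by rewrite -lnN ler_ln ?posrE.
  have h2 : ln m + 2 * ln (norm2 (z t)) <= ln (E t).
    by rewrite -lnN -lnM ?posrE// ler_ln ?posrE// mulr_gt0.
  rewrite -/(z t) ler_norml.
  have := ler_norm (ln m); have := ler_norm (ln (norm2 y)).
  have := ler_norm (- ln m); have := ler_norm (- ln (norm2 y)).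
  by rewrite !normrN; lra.
have E_step t : E t.+1 <= n%:R / m * E t.
  apply: (@le_trans _ _ (n%:R / m * (m * N t))); last first.
    by rewrite ler_wpM2l// divr_ge0// ltW.
  rewrite mulrA divfK ?gt_eqF//; apply: le_trans (E_le _) _.
  apply: le_trans (norm2_le_norm _) _; rewrite ler_wpM2l//.
  apply: le_trans (norm_le_norm2 _); rewrite lerXn2r ?nnegrE//.
  exact: traj_norm_le.
apply: (@convex_slope_cvg _ _ (ln (n%:R / m) / 2)) => t.
  suff : 2 * ln (E t.+1) <= ln (E t) + ln (E t.+2) by lra.
  rewrite -lnM ?posrE// mulr_natl -lnXn// ler_ln ?posrE ?exprn_gt0 ?mulr_gt0//.
  by apply: energy_log_convex => // i; exact: ltW.
have nm_gt0 : 0 < n%:R / m by rewrite divr_gt0// ltr0n.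
suff : ln (E t.+1) <= ln (n%:R / m) + ln (E t) by lra.
by rewrite -lnM ?posrE// ler_ln ?posrE//; exact: mulr_gt0.
Qed.

(** Either the trajectory reaches 0, and the rate is 0, or all logarithms are
finite and their slope, bounded by ln eta at the multiples of n, is the
logarithm of the rate. *)
Lemma centered_rate_cvg (R : realType) (n : nat) (A : 'M[R]_n)
  (p y : 'cV[R]_n) (eta q : R) : (0 < n)%N -> stochastic A -> stationary A p ->
  reversible A p -> (forall i, 0 < p i 0) -> contracts A p q ->
  0 <= q <= eta ^+ n -> 0 < eta -> p^T *m y = 0 -> y != 0 ->
  exists2 L : R, ((fun t => (norm2 (traj A y t) / norm2 y) `^ (t%:R^-1))
    @ \oo --> L)%classic & 0 <= L <= eta.
Proof.
move=> n_gt0 A_st [p_prob pA] A_rev p_gt0 A_con /andP[q_ge0 q_le].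
move=> eta_gt0 py y_neq0.
have [[s ys]|traj_neq0] := pselect (exists s, traj A y s = 0).
  exists 0; first exact: rate_cvg_of_vanishing ys.
  by rewrite lexx ltW.
have z_neq0 t : traj A y t != 0.
  by apply/eqP => yt; apply: traj_neq0; exists t.
have y_gt0 := norm2_gt0 y_neq0.
have f_gt0 t : 0 < norm2 (traj A y t) / norm2 y.
  by rewrite divr_gt0// norm2_gt0.
have l_cvg := log_energy_slope_cvg A_st p_prob A_rev p_gt0 z_neq0.
exists (expR (limn (fun t => ln (norm2 (traj A y t) / norm2 y) / t%:R))).
  exact: powR_slope_cvg.
rewrite expR_ge0 -ler_ln ?posrE ?expR_gt0// expRK /=.
apply: (@slope_lim_le _ _ n (ln n%:R / 2)) => // k.
have eta_k : 0 < eta ^+ (k * n) by rewrite exprn_gt0.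
suff : ln ((norm2 (traj A y (k * n)) / norm2 y) ^+ 2) <=
       ln (n%:R * (eta ^+ (k * n)) ^+ 2).
  rewrite lnM ?posrE ?ltr0n ?exprn_gt0// [ln (_ ^+ 2)]lnXn//.
  rewrite [ln (_ ^+ 2)]lnXn//.
  by rewrite (mulr2n (ln (_ / _))) (mulr2n (ln (_ ^+ _))) lnXn//; lra.
rewrite ler_ln ?posrE ?exprn_gt0//; last by rewrite mulr_gt0 ?ltr0n ?exprn_gt0.
rewrite expr_div_n ler_pdivrMr ?exprn_gt0//.
apply: le_trans (norm2_le_norm _) _; rewrite -mulrA ler_wpM2l//.
apply: (@le_trans _ _ ((eta ^+ (k * n) * `|y|) ^+ 2)).
  rewrite lerXn2r ?nnegrE// ?mulr_ge0// ?(ltW eta_k)//.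
  apply: le_trans (contracts_iter _ q_ge0 pA A_con py) _.
  by rewrite ler_wpM2r// mulnC exprM lerXn2r ?nnegrE// exprn_ge0// ltW.
by rewrite exprMn ler_wpM2l ?norm_le_norm2// exprn_ge0// ltW.
Qed.

(** * A reversible chain attracted to a root *)

(** The function d is the length of a shortest path to r. Such a path repeats
no vertex, so d is less than the number of vertices, and its second vertex is
closer to r. *)
Lemma root_distance (T : finType) (e : rel T) (r : T) :
  (forall x, connect e x r) ->
  exists d : T -> nat, [/\ forall x, (d x < #|T|)%N,
    forall x, d x = 0%N -> x = r, d r = 0%N
    & forall x, x != r -> exists2 y, e x y & (d y < d x)%N].
Proof.
move=> r_conn.
pose P x k := [exists p : k.-tuple T, path e x p && (last x p == r)].
have P_path x (p : seq T) : path e x p -> last x p = r -> P x (size p).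
  move=> xp pr; apply/existsP; exists (in_tuple p) => /=.
  by rewrite xp pr eqxx.
have P_ex x : exists k, P x k.
  by have /connectP[p xp pr] := r_conn x; exists (size p); apply: P_path.
exists (fun x => ex_minn (P_ex x)); split.
- move=> x; case: ex_minnP => m /existsP[p /andP[xp /eqP pr]] m_min.
  move: pr; case/shortenP: xp => p' xp' p'_uniq _ pr.
  apply: leq_trans (max_card (mem (x :: p'))).
  by rewrite (card_uniqP p'_uniq) /= ltnS m_min// P_path.
- move=> x; case: ex_minnP => m /existsP[p /andP[_ /eqP pr]] _ m0.
  by subst m; rewrite tuple0 in pr.
- case: ex_minnP => m _ m_min; apply/eqP; rewrite -leqn0.
  by apply: m_min; exact: (P_path r [::]).
- move=> x xr; case: (ex_minnP (P_ex x)) => -[|m].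
    move=> /existsP[p /andP[_ /eqP pr]] _.
    by rewrite tuple0 /= in pr; rewrite pr eqxx in xr.
  move=> /existsP[p]; case/tupleP: p => y p /= /andP[/andP[xy yp] /eqP pr] _.
  exists y => //; case: ex_minnP => k _ k_min; rewrite ltnS.
  by rewrite -[m](size_tuple p) k_min// P_path.
Qed.

(** By time t, a walk started at distance at most t from r is at r unless one
of its t steps failed to descend. Each step fails with probability at most
n * delta, and a failure changes the value of y by at most 2 * `|y|. The
predecessor d(i) - 1 is truncated at 0, so that staying at r counts as a
descent. *)
Lemma approach_root (R : realType) (n : nat) (A : 'M[R]_n) (d : 'I_n -> nat)
  (r : 'I_n) (delta : R) (y : 'cV[R]_n) :
  stochastic A -> (forall j, d j = 0%N -> j = r) ->
  0 <= delta -> (forall i j, ((d i).-1 < d j)%N -> A i j <= delta) ->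
  forall t i, (d i <= t)%N ->
  `|traj A y t i 0 - y r 0| <= (t * n)%:R * (delta * (2 * `|y|)).
Proof.
move=> A_st d0 delta_ge0 A_le; have [A_ge0 A_sum] := A_st.
elim=> [|t IHt] i dit.
  by move: dit; rewrite leqn0 => /eqP/d0 ->; rewrite subrr normr0 mul0n mul0r.
have -> : traj A y t.+1 i 0 - y r 0 =
          \sum_j A i j * (traj A y t j 0 - y r 0).
  under [RHS]eq_bigr do rewrite mulrBr.
  rewrite sumrB -mulr_suml A_sum mul1r; congr (_ - _); by rewrite /= mxE.
rewrite (le_trans (ler_norm_sum _ _ _))//.
set c := (t * n)%:R * (delta * (2 * `|y|)).
have c_ge0 : 0 <= c by rewrite !mulr_ge0.
have -> : (t.+1 * n)%:R * (delta * (2 * `|y|)) =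
    \sum_j (A i j * c + delta * (2 * `|y|)).
  rewrite big_split /= -mulr_suml A_sum mul1r sumr_const card_ord.
  by rewrite mulSn natrD -[(delta * _) *+ n]mulr_natl /c; ring.
apply: ler_sum => j _; rewrite normrM ger0_norm//.
case: (leqP (d j) (d i).-1) => [dji|dij].
  have djt : (d j <= t)%N.
    by apply: leq_trans dji _; rewrite -ltnS; case: (d i) dit.
  rewrite (le_trans (ler_wpM2l (A_ge0 i j) (IHt j djt)))// lerDl.
  by rewrite !mulr_ge0.
apply: (@le_trans _ _ (delta * (2 * `|y|))); last by rewrite lerDr mulr_ge0.
apply: ler_pM => //; first exact: A_le.
rewrite (le_trans (ler_normB _ _))// mulr_natl mulr2n lerD ?entry_le_norm//.
by rewrite (le_trans (entry_le_norm _ _))// (traj_norm_le y A_st (leq0n t)).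
Qed.

(** After n steps all entries are within B of y r; as their p-mean is 0, the
value y r is itself at most B. *)
Lemma approach_root_contracts (R : realType) (n : nat) (A : 'M[R]_n)
  (p : 'cV[R]_n) (d : 'I_n -> nat) (r : 'I_n) (delta : R) :
  stochastic A -> stationary A p -> (forall j, (d j < n)%N) ->
  (forall j, d j = 0%N -> j = r) -> 0 <= delta ->
  (forall i j, ((d i).-1 < d j)%N -> A i j <= delta) ->
  contracts A p (4 * (n * n)%:R * delta).
Proof.
move=> A_st [p_prob pA] d_lt d0 delta_ge0 A_le y py.
pose B := (n * n)%:R * (delta * (2 * `|y|)).
have B_ge0 : 0 <= B by rewrite !mulr_ge0.
have close : `|traj A y n - const_mx (y r 0)| <= B.
  apply: norm_le_entry => // i; rewrite !mxE.
  by apply: (approach_root y A_st d0 delta_ge0 A_le); exact: ltnW.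
have yr_le : `|y r 0| <= B.
  have := prob_mean_norm_le (traj A y n - const_mx (y r 0)) p_prob.
  rewrite mulmxBr traj_mean// py sub0r [X in `|X|]mxE normrN.
  by rewrite prob_mean_const// => /le_trans; apply.
have -> : 4 * (n * n)%:R * delta * `|y| = B + B by rewrite /B; ring.
rewrite -[X in `|X|](subrK (const_mx (y r 0))).
rewrite (le_trans (ler_normD _ _))// lerD// norm_le_entry// => i.
by rewrite mxE.
Qed.

Definition gibbs_weight (R : realType) (n : nat) (e : rel 'I_n)
  (v : 'I_n -> R) (i : 'I_n) : R := \sum_k (e i k)%:R * v k.

Definition gibbs_chain (R : realType) (n : nat) (e : rel 'I_n)
  (v : 'I_n -> R) : 'M[R]_n :=
  \matrix_(i, j) ((e i j)%:R * v j / gibbs_weight e v i).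

Definition gibbs_measure (R : realType) (n : nat) (e : rel 'I_n)
  (v : 'I_n -> R) : 'cV[R]_n :=
  \col_i (v i * gibbs_weight e v i / \sum_k v k * gibbs_weight e v k).

Lemma gibbs_weight_ge (R : realType) (n : nat) (e : rel 'I_n)
  (v : 'I_n -> R) i k : (forall j, 0 < v j) -> e i k ->
  v k <= gibbs_weight e v i.
Proof.
move=> v_gt0 ik; rewrite /gibbs_weight (bigD1 k)//= ik mul1r lerDl.
by apply: sumr_ge0 => j _; rewrite mulr_ge0// ltW.
Qed.

Lemma gibbs_weight_gt0 (R : realType) (n : nat) (e : rel 'I_n)
  (v : 'I_n -> R) i : (forall j, 0 < v j) -> reflexive e ->
  0 < gibbs_weight e v i.
Proof.
move=> v_gt0 e_refl.
exact: lt_le_trans (v_gt0 i) (gibbs_weight_ge v_gt0 (e_refl i)).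
Qed.

Lemma gibbs_mass_gt0 (R : realType) (n : nat) (e : rel 'I_n)
  (v : 'I_n -> R) : (0 < n)%N -> (forall j, 0 < v j) -> reflexive e ->
  0 < \sum_k v k * gibbs_weight e v k.
Proof.
move=> n_gt0 v_gt0 e_refl; have vZ_gt0 j : 0 < v j * gibbs_weight e v j.
  by rewrite mulr_gt0 ?gibbs_weight_gt0.
rewrite (bigD1 (Ordinal n_gt0))//= ltr_wpDr//.
by apply: sumr_ge0 => j _; exact: ltW.
Qed.

Lemma gibbs_chain_stochastic (R : realType) (n : nat) (e : rel 'I_n)
  (v : 'I_n -> R) : (forall j, 0 < v j) -> reflexive e ->
  stochastic (gibbs_chain e v).
Proof.
move=> v_gt0 e_refl; have Z_gt0 i := gibbs_weight_gt0 i v_gt0 e_refl.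
split=> [i j|i].
  by rewrite mxE mulr_ge0 ?invr_ge0 ?(ltW (Z_gt0 i))// mulr_ge0// ltW.
under eq_bigr do rewrite mxE.
by rewrite -mulr_suml divff//; exact: lt0r_neq0 (Z_gt0 i).
Qed.

Lemma gibbs_chain_supported (R : realType) (n : nat) (e : rel 'I_n)
  (v : 'I_n -> R) : supported e (gibbs_chain e v).
Proof. by move=> i j /negbTE ij; rewrite mxE ij !mul0r. Qed.

(** Up to normalization, both sides are e i j * v i * v j. *)
Lemma gibbs_chain_reversible (R : realType) (n : nat) (e : rel 'I_n)
  (v : 'I_n -> R) : (forall j, 0 < v j) -> reflexive e -> symmetric e ->
  reversible (gibbs_chain e v) (gibbs_measure e v).
Proof.
move=> v_gt0 e_refl e_sym i j; rewrite !mxE e_sym.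
have Z_neq0 k : gibbs_weight e v k != 0 by rewrite gt_eqF// gibbs_weight_gt0.
have S_neq0 : \sum_k v k * gibbs_weight e v k != 0.
  by rewrite gt_eqF// gibbs_mass_gt0// (leq_ltn_trans _ (ltn_ord i)).
by field; rewrite !Z_neq0 S_neq0.
Qed.

Lemma gibbs_measure_gt0 (R : realType) (n : nat) (e : rel 'I_n)
  (v : 'I_n -> R) i : (forall j, 0 < v j) -> reflexive e ->
  0 < gibbs_measure e v i 0.
Proof.
move=> v_gt0 e_refl.
rewrite mxE divr_gt0 ?mulr_gt0 ?gibbs_weight_gt0// gibbs_mass_gt0//.
exact: leq_ltn_trans (ltn_ord i).
Qed.

Lemma gibbs_measure_prob (R : realType) (n : nat) (e : rel 'I_n)
  (v : 'I_n -> R) : (0 < n)%N -> (forall j, 0 < v j) -> reflexive e ->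
  prob_vector (gibbs_measure e v).
Proof.
move=> n_gt0 v_gt0 e_refl.
split=> [i|]; first by rewrite ltW// gibbs_measure_gt0.
under eq_bigr do rewrite mxE.
by rewrite -mulr_suml divff//; exact: lt0r_neq0 (gibbs_mass_gt0 _ _ _).
Qed.

(** A descending neighbour k of i contributes delta ^ d k to the normalization,
and every j with d j > d k has weight at most delta * delta ^ d k. *)
Lemma gibbs_chain_descends (R : realType) (n : nat) (e : rel 'I_n)
  (d : 'I_n -> nat) (delta : R) : reflexive e -> 0 < delta <= 1 ->
  (forall i, exists2 k, e i k & (d k <= (d i).-1)%N) ->
  forall i j, ((d i).-1 < d j)%N ->
  gibbs_chain e (fun k => delta ^+ d k) i j <= delta.
Proof.
move=> e_refl /andP[delta_gt0 delta_le1] descend i j dij.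
have v_gt0 k : 0 < delta ^+ d k by rewrite exprn_gt0.
have [k ik dki] := descend i.
rewrite mxE ler_pdivrMr ?gibbs_weight_gt0//.
apply: (@le_trans _ _ (delta ^+ d j)).
  by case: (e i j); rewrite ?mul1r// mul0r ltW.
apply: (@le_trans _ _ (delta * delta ^+ d k)).
  by rewrite -exprS ler_wiXn2l// ?ltW// (leq_ltn_trans dki).
apply: ler_wpM2l; first exact: ltW.
exact: (gibbs_weight_ge (v := fun k => delta ^+ d k)).
Qed.

Lemma contracting_chain_exists (R : realType) (n : nat) (e : rel 'I_n)
  (q : R) : (0 < n)%N -> symmetric e -> reflexive e ->
  (forall i j, connect e i j) -> 0 < q <= 1 ->
  exists (A : 'M[R]_n) (p : 'cV[R]_n),
    [/\ [/\ stochastic A, supported e A & stationary A p],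
        reversible A p, forall i, 0 < p i 0 & contracts A p q].
Proof.
move=> n_gt0 e_sym e_refl e_conn /andP[q_gt0 q_le1].
pose r := Ordinal n_gt0.
have [d [d_lt d0 dr descend]] := root_distance (fun i => e_conn i r).
have nn_gt0 : 0 < 4 * (n * n)%:R :> R.
  by rewrite mulr_gt0// ltr0n muln_gt0 n_gt0.
pose delta := q / (4 * (n * n)%:R).
have delta_gt0 : 0 < delta by rewrite divr_gt0.
have delta_le1 : delta <= 1.
  rewrite ler_pdivrMr// mul1r (le_trans q_le1)// -natrM ler1n.
  by rewrite !muln_gt0 n_gt0.
pose v i := delta ^+ d i.
have v_gt0 i : 0 < v i by rewrite exprn_gt0.
have A_st : stochastic (gibbs_chain e v) by exact: gibbs_chain_stochastic.
have A_rev : reversible (gibbs_chain e v) (gibbs_measure e v).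
  exact: gibbs_chain_reversible.
have p_st : stationary (gibbs_chain e v) (gibbs_measure e v).
  by split; [exact: gibbs_measure_prob|exact: reversible_invariant].
exists (gibbs_chain e v), (gibbs_measure e v); split=> //.
- by split=> //; exact: gibbs_chain_supported.
- by move=> i; exact: gibbs_measure_gt0.
have -> : q = 4 * (n * n)%:R * delta by rewrite mulrC divfK// gt_eqF.
apply: (@approach_root_contracts _ _ _ _ d r) => //.
- by move=> j; rewrite -[X in (_ < X)%N]card_ord d_lt.
- exact: ltW.
apply: gibbs_chain_descends => //; first by rewrite delta_gt0.
move=> i; have [->|/descend[k ik dki]] := eqVneq i r.
  by exists r; rewrite ?dr.
by exists k => //; rewrite -ltnS (leq_trans dki)// leqSpred.
Qed.

(** * Convergence rate and convergence time of a contracting chain *)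

Lemma nonconsensus_exists (R : realType) (n : nat) :
  (1 < n)%N -> exists x : 'cV[R]_n, ~ consensus_set R n x.
Proof.
move=> n_gt1; pose i0 := Ordinal (ltnW n_gt1); pose i1 := Ordinal n_gt1.
exists (delta_mx i0 0) => -[c xc].
have := congr1 (fun x : 'cV[R]_n => x i0 0 - x i1 0) xc.
by rewrite /= !mxE eqxx /= subr0 subrr => /eqP; rewrite oner_eq0.
Qed.

(** Real bounds on all the limits, over a nonempty family since 1 < n, make
the supremum finite. *)
Lemma convergence_rate_le (R : realType) (n : nat) (A : 'M[R]_n) (eta : R) :
  (1 < n)%N ->
  (forall x0, ~ consensus_set R n x0 ->
    exists2 L : R, (rate_seq A x0 @ \oo --> L)%classic & 0 <= L <= eta) ->
  exists rho : R, is_convergence_rate A rho /\ rho <= eta.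
Proof.
move=> n_gt1 rates.
set S := [set (lim (rate_seq A x0 @ \oo))%:E
         | x0 in ~` consensus_set R n]%classic.
have S_le s : S s -> (0 <= s <= eta%:E)%E.
  move=> [x0 /rates[L L_cvg L_le] <-].
  by rewrite (cvg_lim (@norm_hausdorff _ _) L_cvg) !lee_fin.
have sup_le : (ereal_sup S <= eta%:E)%E.
  by apply: ge_ereal_sup => s /S_le /andP[].
have sup_ge : (0 <= ereal_sup S)%E.
  have [x0 x0_ncons] := nonconsensus_exists R n_gt1.
  have S_x0 : S (lim (rate_seq A x0 @ \oo)%classic)%:E by exists x0.
  apply: le_trans (ereal_sup_ubound S_x0).
  by have /andP[] := S_le _ S_x0.
have sup_fin : ereal_sup S \is a fin_num.
  by rewrite fin_numE; apply/andP; split;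
    [rewrite gt_eqF// (lt_le_trans _ sup_ge) ?ltNy0
    |rewrite lt_eqF// (le_lt_trans sup_le) ?ltry].
exists (fine (ereal_sup S)); split; last by rewrite -lee_fin fineK.
split; last by rewrite fineK.
by move=> x0 /rates[L L_cvg _]; exact: cvgP L_cvg.
Qed.

Lemma convergence_time_le (R : realType) (n : nat) (A : 'M[R]_n) (eps : R)
  (tau : nat) : eps_settled A eps tau ->
  exists T : nat, is_convergence_time A eps T /\ (T <= tau)%N.
Proof.
move=> tau_settled.
have ex_settled : exists t, `[< eps_settled A eps t >].
  by exists tau; apply/asboolP.
exists (ex_minn ex_settled); case: ex_minnP => T /asboolP T_settled T_min.
split; last by apply: T_min; apply/asboolP.
by split=> // t t_settled; apply: T_min; apply/asboolP.
Qed.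

Lemma contracts_rate_le (R : realType) (n : nat) (A : 'M[R]_n)
  (p : 'cV[R]_n) (eta q : R) : (1 < n)%N -> stochastic A -> stationary A p ->
  reversible A p -> (forall i, 0 < p i 0) -> contracts A p q ->
  0 <= q < 1 -> q <= eta ^+ n -> 0 < eta ->
  exists rho : R, is_convergence_rate A rho /\ rho <= eta.
Proof.
move=> n_gt1 A_st p_st A_rev p_gt0 A_con q01 q_le eta_gt0.
have [p_prob _] := p_st; have /andP[q_ge0 _] := q01.
apply: convergence_rate_le => // x0 x0_ncons.
pose c := (p^T *m x0) 0 0; pose y := x0 - const_mx c.
have -> : rate_seq A x0 =
    (fun t => (norm2 (traj A y t) / norm2 y) `^ (t%:R^-1)).
  apply/funext => t; rewrite /rate_seq (traj_limitE x0 A_st p_st q01 A_con).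
  by rewrite -traj_sub_const.
apply: (@centered_rate_cvg _ _ _ p y eta q) => //; first exact: ltnW.
- by rewrite q_ge0.
- exact: mean_centered.
- exact: centered_neq0.
Qed.

Lemma contracting_chain_unique_stationary (R : realType) (n : nat)
  (A : 'M[R]_n) (p : 'cV[R]_n) (q : R) : stochastic A -> stationary A p ->
  (forall i, 0 < p i 0) -> 0 <= q < 1 -> contracts A p q ->
  unique_positive_stationary A.
Proof.
move=> A_st p_st p_gt0 q01 A_con; exists p; split=> // r r_st.
exact: contracts_stationary_unique A_st p_st q01 A_con r_st.
Qed.

Unset Implicit Arguments.

Theorem mainTheorem9 (R : realType) (n : nat) (hn : (1 < n)%N)
  (e : rel 'I_n) (e_sym : symmetric e) (e_loops : reflexive e)
  (e_conn : forall i j : 'I_n, connect e i j) :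
  (forall eta : R, 0 < eta ->
     exists A : 'M[R]_n,
       [/\ stochastic A, supported e A, unique_positive_stationary A,
           reaches_consensus A
         & exists rho : R, is_convergence_rate A rho /\ rho <= eta]) /\
  (forall eps : R, 0 < eps ->
     exists A : 'M[R]_n,
       [/\ stochastic A, supported e A, unique_positive_stationary A,
           reaches_consensus A
         & exists T : nat, is_convergence_time A eps T /\ (T <= n)%N]).
Proof.
(* The cap 1/2 keeps the factor below 1 when the target c is large. *)
have chain (c : R) : 0 < c -> exists (A : 'M[R]_n) (p : 'cV[R]_n) (q : R),
    [/\ [/\ stochastic A, supported e A & stationary A p], reversible A p,
        forall i, 0 < p i 0, contracts A p q & 0 <= q < 1 /\ q <= c].
  move=> c_gt0; pose q : R := Num.min c 2^-1.
  have q_gt0 : 0 < q by rewrite lt_min c_gt0 invr_gt0 ltr0n.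
  have q_le : q <= 2^-1 by rewrite ge_min lexx orbT.
  have q_lt1 : q < 1 by lra.
  have q01 : 0 < q <= 1 by rewrite q_gt0 ltW.
  have [A [p [A_st A_rev p_gt0 A_con]]] :=
    contracting_chain_exists (ltnW hn) e_sym e_loops e_conn q01.
  exists A, p, q; split=> //; split; first by rewrite ltW.
  by rewrite ge_min lexx.
split=> c c_gt0.
- have /chain[A [p [q]]] : 0 < c ^+ n by rewrite exprn_gt0.
  move=> [[A_st A_sup p_st] A_rev p_gt0 A_con [q01 q_le]].
  exists A; split=> //.
  + exact: contracting_chain_unique_stationary p_st p_gt0 q01 A_con.
  + exact: contracts_reaches_consensus p_st q01 A_con.
  + exact: contracts_rate_le A_rev p_gt0 A_con q01 q_le c_gt0.
- have [A [p [q]]] := chain c c_gt0.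
  move=> [[A_st A_sup p_st] A_rev p_gt0 A_con [q01 q_le]].
  exists A; split=> //.
  + exact: contracting_chain_unique_stationary p_st p_gt0 q01 A_con.
  + exact: contracts_reaches_consensus p_st q01 A_con.
  + apply: convergence_time_le => t nt x0 x0_ncons.
    apply: le_trans q_le.
    exact: (contracts_settled A_st p_st q01 A_con nt).
Qed.
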